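(* Let $A\in\mathbb{C}^{n\times n}$, let $B=B^H\in\mathbb{C}^{n\times n}$ be Hermitian positive definite with upper triangular Cholesky factor $R$ (so $B=R^HR$), and let $\theta>0$ be a real constant. Define the Hermitian matrix $$G(\theta)=\begin{pmatrix}\theta B & A^H\\ A & \theta B\end{pmatrix}\in\mathbb{C}^{2n\times 2n}.$$ If $\mathrm{npe}(G(\theta))=n$, then $$\sigma_{\min}(R^{-H}AR^{-1})\geq\theta.$$
   Context: For a Hermitian matrix $M$, $\mathrm{npe}(M)$ denotes the number of positive eigenvalues of $M$, counted with multiplicity. $M^H$ is the conjugate transpose, $R^{-H}=(R^H)^{-1}$, and $\sigma_{\min}(M)$ denotes the smallest singular value of a square matrix $M$. *)

(* Defs.v *)
(* The complex numbers are K[i] for a realType K. *)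
From HB Require Import structures.
From mathcomp Require Export all_boot all_order all_algebra.
From mathcomp Require Export complex reals.

Set Implicit Arguments.
Unset Strict Implicit.
Unset Printing Implicit Defensive.

Import Order.TTheory GRing.Theory Num.Theory.
Local Open Scope ring_scope.
Local Open Scope complex_scope.
Local Open Scope sesquilinear_scope.

(* The eigenvalues, repeated according to algebraic multiplicity. *)
Definition eigvals (C : numClosedFieldType) n (M : 'M[C]_n) : seq C :=
  sval (closed_field_poly_normal (char_poly M)).

Lemma char_poly_eigvals (C : numClosedFieldType) n (M : 'M[C]_n) :
  char_poly M = \prod_(a <- eigvals M) ('X - a%:P).
Proof.
rewrite /eigvals; case: closed_field_poly_normal => r /= Er; rewrite {1}Er.
by rewrite (monicP (char_poly_monic M)) scale1r.
Qed.

(* In the partial order of C, 0 < a means that a is real and positive. *)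
Definition npe (C : numClosedFieldType) n (M : 'M[C]_n) : nat :=
  count (fun a => 0 < a) (eigvals M).

Definition posdefmx (C : numClosedFieldType) n (M : 'M[C]_n) : Prop :=
  M \is hermsymmx /\
  forall x : 'cV[C]_n, x != 0 -> 0 < (x^t* *m M *m x) 0 0.

(* The usual normalisation of the Cholesky factor: its diagonal entries are
   real and positive. *)
Definition cholesky_factor (C : numClosedFieldType) n (B R : 'M[C]_n) : Prop :=
  [/\ is_trig_mx R^T, forall i, 0 < R i i & B = R^t* *m R].

(* The eigenvalues of M^H M are real and nonnegative, so taking their real
   parts loses nothing. *)
Definition singvals (K : rcfType) n (M : 'M[K[i]]_n) : seq K :=
  [seq Num.sqrt (complex.Re a) | a <- eigvals (M^t* *m M)].

(* For n > 0 the unit of the iterated minimum is itself a singular value, hence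
   this is their minimum; for n = 0 there are no singular values. *)
Definition sigma_min (K : rcfType) n (M : 'M[K[i]]_n) : K :=
  \big[Num.min / head 0 (singvals M)]_(s <- singvals M) s.

Definition Gmx (K : rcfType) n (A B : 'M[K[i]]_n) (theta : K) :
    'M[K[i]]_(n + n) :=
  block_mx (theta%:C *: B) (A^t*) A (theta%:C *: B).

(* Main.v *)
Require Import Defs.

(** The proof is the contrapositive of a dimension count.  Write
    M = R^-H A R^-1.  Congruence by diag(R^-1, R^-1) turns G(theta) into

      G' = [theta I, M^H; M, theta I].

    Both diagonal blocks are positive, so n positive eigenvalues are always
    present; the point is that one more appears as soon as some singular value
    s of M is below theta.  Indeed, let v be an eigenvector of M^H M with
    eigenvalue a = s^2 < theta^2.  The vector (theta v, - M v) and the n vectors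
    (0, e_j) are G'-orthogonal, and the form takes on the first one the value
    theta (theta^2 - a) |v|^2 > 0 and on the others the value theta > 0.  So G'
    is positive definite on a space of dimension n + 1 ([npe_Gmx_gt]), which
    contradicts npe(G(theta)) = n.

    The passage from such a subspace to eigenvalues is the easy half of
    Sylvester's law of inertia ([npe_ge]), obtained from the spectral theorem:
    a subspace of dimension larger than npe contains a nonzero vector
    orthogonal to all eigenvectors with positive eigenvalue, and the form is
    not positive there. *)

Set Implicit Arguments.
Unset Strict Implicit.
Unset Printing Implicit Defensive.

Import Order.TTheory GRing.Theory Num.Theory.
Local Open Scope ring_scope.
Local Open Scope complex_scope.
Local Open Scope sesquilinear_scope.

Lemma trmxC_mul (C : numClosedFieldType) m n p
    (X : 'M[C]_(m, n)) (Y : 'M[C]_(n, p)) :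
  (X *m Y)^t* = Y^t* *m X^t*.
Proof. by rewrite trmx_mul map_mxM. Qed.

Lemma hermsymmxE (C : numClosedFieldType) n (M : 'M[C]_n) :
  (M \is hermsymmx) = (M^t* == M).
Proof. by rewrite qualifE /= expr0 scale1r eq_sym. Qed.

Lemma char_poly_similar (F : fieldType) n (P M : 'M[F]_n) :
  P \in unitmx -> char_poly (invmx P *m M *m P) = char_poly M.
Proof.
move=> uP; rewrite /char_poly.
have -> : char_poly_mx (invmx P *m M *m P) =
    map_mx polyC (invmx P) *m char_poly_mx M *m map_mx polyC P.
  rewrite /char_poly_mx mulmxBr mulmxBl -!map_mxM; congr (_ - _).
  by rewrite scalar_mxC -mulmxA -map_mxM mulVmx // map_mx1 mulmx1.
rewrite !det_mulmx mulrAC -det_mulmx -map_mxM mulVmx // map_mx1 det1.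
by rewrite mul1r.
Qed.

(** [eigvals] lists the roots of the characteristic polynomial in an
    unspecified order, so it can agree with the spectral diagonal only up to a
    permutation, which is enough for counting. *)
Lemma eigvals_spectral (C : numClosedFieldType) n (M : 'M[C]_n) :
  M \is normalmx ->
  perm_eq (eigvals M) [seq spectral_diag M 0 i | i <- enum 'I_n].
Proof.
move=> /orthomx_spectralP Mn; apply: prod_XsubC_eq; rewrite -char_poly_eigvals.
rewrite {1}Mn char_poly_similar ?spectral_unit //.
rewrite char_poly_trig ?diag_mx_is_trig // big_map big_enum /=.
by apply: eq_bigr => i _; rewrite mxE eqxx mulr1n.
Qed.

Lemma npe_spectral (C : numClosedFieldType) n (M : 'M[C]_n) :
  M \is normalmx -> npe M = #|[set i | 0 < spectral_diag M 0 i]|.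
Proof.
move=> Mn; rewrite /npe (permP (eigvals_spectral Mn)) count_map cardE.
rewrite -size_filter enumT /enum_mem; congr size.
by apply: eq_filter => i; rewrite /= inE.
Qed.

Lemma diag_formE (C : numClosedFieldType) n (d : 'rV[C]_n) (x : 'cV[C]_n) :
  (x^t* *m diag_mx d *m x) 0 0 = \sum_i d 0 i * `|x i 0| ^+ 2.
Proof.
rewrite mul_mx_diag mxE; apply: eq_bigr => i _.
by rewrite !mxE normCK mulrAC mulrC [_ * x i 0]mulrC.
Qed.

Lemma diag_form_gt0 (C : numClosedFieldType) n (d : 'rV[C]_n) (x : 'cV[C]_n) :
  (forall i, 0 < d 0 i) -> x != 0 -> 0 < (x^t* *m diag_mx d *m x) 0 0.
Proof.
move=> d0 x0; rewrite diag_formE; have [i xi] : exists i, x i 0 != 0.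
  apply/existsP; apply: contraNT x0 => /existsPn x0; apply/eqP/colP => i.
  by rewrite mxE; apply/eqP; have := x0 i; rewrite negbK.
rewrite (bigD1 i) //= ltr_pwDl ?mulr_gt0 ?exprn_gt0 ?normr_gt0 //.
by apply: sumr_ge0 => j _; rewrite mulr_ge0 ?exprn_ge0 // ltW.
Qed.

Lemma wide_ker (F : fieldType) p k (N : 'M[F]_(p, k)) :
  (p < k)%N -> exists2 x : 'cV[F]_k, x != 0 & N *m x = 0.
Proof.
move=> lt_pk; have : kermx N^T != 0.
  rewrite -mxrank_eq0 mxrank_ker -lt0n subn_gt0.
  exact: leq_ltn_trans (rank_leq_col _) lt_pk.
case/rowV0Pn => x /sub_kermxP xN x0; exists x^T; first by rewrite trmx_eq0.
by apply: trmx_inj; rewrite trmx_mul trmxK xN trmx0.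
Qed.

(** The half of Sylvester's law of inertia that bounds npe from below.  The
    subspace is given by the columns of Q, whose independence is implied by the
    positivity; Q is a parameter so that congruences can be absorbed in it. *)
Lemma npe_ge (C : numClosedFieldType) m k (M : 'M[C]_m) (Q : 'M[C]_(m, k)) :
  M \is hermsymmx ->
  (forall x : 'cV[C]_k, x != 0 -> 0 < (x^t* *m (Q^t* *m M *m Q) *m x) 0 0) ->
  (k <= npe M)%N.
Proof.
move=> Mh Qpos; have Mn := hermitian_normalmx Mh.
rewrite (npe_spectral Mn) leqNgt; apply/negP => lt_k.
set S := [set i | _] in lt_k; set P := spectralmx M.
pose N := rowsub (fun j : 'I_#|S| => enum_val j) (P *m Q).
(* N x = 0 says that Q x has no component along the positive eigenvectors. *)
have [x x0 Nx] := wide_ker N lt_k.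
have zS i : i \in S -> (P *m Q *m x) i 0 = 0.
  move=> iS; have := congr1 (fun X : 'cV_ _ => X (enum_rank_in iS i) 0) Nx.
  by rewrite /N mul_rowsub_mx !mxE enum_rankK_in.
have := Qpos x x0; have /orthomx_spectralP -> := Mn.
rewrite invmx_unitary ?spectral_unitarymx // -/P.
have -> : x^t* *m (Q^t* *m (P^t* *m diag_mx (spectral_diag M) *m P) *m Q) *m x
    = (P *m Q *m x)^t* *m diag_mx (spectral_diag M) *m (P *m Q *m x).
  by rewrite !trmxC_mul !mulmxA.
rewrite diag_formE; apply/negP; rewrite le_gtF //.
apply: sumr_le0 => i _; have [iS|] := boolP (i \in S).
  by rewrite zS // normr0 expr0n mulr0.
rewrite inE => di; apply: mulr_le0_ge0; last by rewrite exprn_ge0.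
rewrite -real_leNgt ?real0 // in di.
by move/mxOverP: (hermitian_spectral_diag_real Mh).
Qed.

(** [eigenvalue] provides a left eigenvector w; as a is real, the adjoint of w
    is a right eigenvector.  That a is nonnegative follows from
    a |w|^2 = |w M^H|^2. *)
Lemma gram_eigval (C : numClosedFieldType) m n (M : 'M[C]_(m, n)) (a : C) :
  a \in eigvals (M^t* *m M) ->
  0 <= a /\ exists2 v : 'cV[C]_n, v != 0 & M^t* *m M *m v = a *: v.
Proof.
move=> ha.
have : eigenvalue (M^t* *m M) a.
  by rewrite eigenvalue_root_char char_poly_eigvals root_prod_XsubC.
case/eigenvalueP => w wM w0.
have a0 : 0 <= a.
  have w2 : 0 < dotmx w w by apply: dotmx_is_dotmx.
  rewrite -(pmulr_lge0 _ w2) dotmxE.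
  have -> : a * (w *m w^t*) 0 0 = ((w *m M^t*) *m (w *m M^t*)^t*) 0 0.
    by rewrite trmxC_mul trmxCK mulmxA -(mulmxA w) wM -scalemxAl [RHS]mxE.
  rewrite -dotmxE; have [->|/dotmx_is_dotmx/ltW //] := eqVneq (w *m M^t*) 0.
  by rewrite dotmxE mul0mx mxE.
split => //; exists (w^t*).
  apply: contra_neq w0 => /(congr1 (fun X => X^t*)).
  by rewrite trmxCK => ->; rewrite trmx0 map_mx0.
have := congr1 (fun X => X^t*) wM; rewrite !trmxC_mul trmxCK => ->.
by rewrite linearZ /= map_mxZ; congr (_ *: _); apply/CrealP/ger0_real.
Qed.

(** A singular value of M below theta enters through its square a, which keeps
    square roots out of the matrix computation: that value and the lower block
    yield n + 1 pairwise orthogonal positive directions of the form G. *)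
Lemma npe_Gmx_gt (K : rcfType) n (A R : 'M[K[i]]_n) (theta : K) (a : K[i]) :
  let M := invmx (R^t*) *m A *m invmx R in
  R \in unitmx -> 0 < theta ->
  a \in eigvals (M^t* *m M) -> a < theta%:C ^+ 2 ->
  (n < npe (Gmx A (R^t* *m R) theta))%N.
Proof.
move=> M uR theta0 /gram_eigval [a0 [v v0 Mv]] lt_a.
set t := theta%:C in lt_a *.
have t0 : 0 < t by rewrite ltcE eqxx.
have tC : (t^*)%R = t by apply/CrealP/gtr0_real.
have uRh : R^t* \in unitmx by rewrite map_unitmx unitmx_tr.
have Gh : Gmx A (R^t* *m R) theta \is hermsymmx.
  rewrite hermsymmxE /Gmx -/t tr_block_mx map_block_mx trmxCK.
  by rewrite !linearZ /= !map_mxZ /= tC trmxC_mul trmxCK.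
pose S := block_mx (invmx R) 0 0 (invmx R).
(* The lower half - M v of the first column is chosen so that the lower half
   of G' Q vanishes there, that is, to complete the square; the factor theta
   in the upper half spares a division. *)
pose Q := block_mx (t *: v) 0 (- (M *m v)) 1%:M : 'M_(n + n, 1 + n).
pose s := (v^t* *m v) 0 0.
have s0 : 0 < s.
  have := @diag_form_gt0 _ _ (const_mx 1) v _ v0.
  by rewrite diag_const_mx mulmx1; apply=> i; rewrite mxE ltr01.
have SGS : S^t* *m Gmx A (R^t* *m R) theta *m S = block_mx t%:M (M^t*) M t%:M.
  have iRh : (invmx R)^t* = invmx (R^t*) by rewrite trmx_inv map_invmx.
  rewrite /S /Gmx -/t tr_block_mx map_block_mx iRh !trmx0 !map_mx0 !mulmx_block.
  rewrite !mul0mx !mulmx0 !addr0 !add0r.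
  rewrite -!scalemxAr -!scalemxAl mulKmx // mulmxV // scalemx1.
  by rewrite /M !trmxC_mul -iRh trmxCK !mulmxA.
have QGQ : (S *m Q)^t* *m Gmx A (R^t* *m R) theta *m (S *m Q) =
    diag_mx (row_mx (const_mx (t * (t ^+ 2 - a) * s)) (const_mx t)).
  rewrite trmxC_mul.
  have -> : Q^t* *m S^t* *m Gmx A (R^t* *m R) theta *m (S *m Q) =
      Q^t* *m (S^t* *m Gmx A (R^t* *m R) theta *m S *m Q) by rewrite !mulmxA.
  rewrite SGS /Q !mulmx_block tr_block_mx map_block_mx mulmx_block.
  have -> : t%:M *m (t *: v) + M^t* *m - (M *m v) = (t ^+ 2 - a) *: v.
    by rewrite mul_scalar_mx scalerA mulmxN mulmxA Mv scalerBl expr2.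
  have -> : M *m (t *: v) + t%:M *m - (M *m v) = 0.
    by rewrite -scalemxAr mul_scalar_mx scalerN subrr.
  have -> : (t *: v)^t* = t *: v^t* by rewrite linearZ /= map_mxZ /= tC.
  have -> : (- (M *m v))^t* = - (v^t* *m M^t*).
    by rewrite linearN /= map_mxN trmxC_mul.
  rewrite !trmx0 !map_mx0 trmx1 map_mx1 !mulmx0 !mul0mx !mulmx1 !mul1mx.
  rewrite !add0r !addr0 mulNmx mul_mx_scalar -!scalemxAl subrr.
  rewrite diag_mx_row !diag_const_mx; congr block_mx.
  rewrite -scalemxAr scalerA.
  by rewrite [v^t* *m v]mx11_scalar -/s scale_scalar_mx.
apply: npe_ge (S *m Q) Gh _ => x x0; rewrite QGQ diag_form_gt0 // => i.
rewrite mxE; case: split => j; rewrite mxE //.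
by rewrite !mulr_gt0 ?subr_gt0.
Qed.

Theorem theorem3 (K : realType) (n : nat) (hn : (0 < n)%N)
    (A B R : 'M[K[i]]_n) (theta : K)
    (hB : posdefmx B) (hR : cholesky_factor B R) (htheta : 0 < theta)
    (hG : npe (Gmx A B theta) = n) :
  theta <= sigma_min (invmx (R^t*) *m A *m invmx R).
Proof.
case: hR => Rtrig Rdiag defB.
have uR : R \in unitmx.
  rewrite -unitmx_tr unitmxE det_trig // unitfE; apply/prodf_neq0 => i _.
  by rewrite mxE gt_eqF.
set M := invmx (R^t*) *m A *m invmx R.
have hs s : s \in singvals M -> theta <= s.
  case/mapP => a aM ->; rewrite leNgt; apply/negP => lt_a.
  suff : (n < npe (Gmx A (R^t* *m R) theta))%N by rewrite -defB hG ltnn.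
  apply: npe_Gmx_gt (aM) _ => //.
  (* As a is real, it can be compared with theta^2 through its real part. *)
  have [] := gram_eigval aM; rewrite lecE => /andP[/eqP Ima Rea] _.
  rewrite -rmorphXn ltcE /= Ima eqxx -(sqr_sqrtr Rea).
  by rewrite ltr_pXn2r ?nnegrE ?sqrtr_ge0 ?ltW.
rewrite /sigma_min big_seq; apply: le_bigmin => //.
(* The unit of the minimum is a singular value because n > 0. *)
apply: hs; rewrite -nth0 mem_nth // size_map.
have := size_char_poly (M^t* *m M).
by rewrite char_poly_eigvals size_prod_XsubC => -[->].
Qed.
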